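(* Let $n\ge2$ and let $C\subset\mathbb{R}^n$ be a Minkowski-centered convex body with $0$ in its interior. The following are equivalent: (i) $\delta_{\mathrm{HM}}=\frac{s(C)+1}{2}$; (ii) $\frac{s(C)+1}{2}C_{\mathrm{HM}}$ is a completion of $C$ with respect to the diameter $D_{\mathrm{HM}}(\cdot,C)$; (iii) $D(C,C_{\mathrm{HM}})=2R(C,C_{\mathrm{HM}})$.
   Context: A convex body is a nonempty compact convex set. $\|x\|_C=\min\{\lambda\ge0:x\in\lambda C\}$ is the gauge function and $C^\circ=\{a:a^Tx\le1\ \forall x\in C\}$ the polar. The circumradius is $R(K,C)=\inf\{\rho\ge0:\exists t,\ K\subset t+\rho C\}$. The Minkowski asymmetry is $s(C)=R(C,-C)$, and $C$ is Minkowski-centered if $C\subset -s(C)C$. $C_{\mathrm{HM}}=\left(\frac{C^\circ-C^\circ}{2}\right)^\circ$ and $C_{\mathrm{AM}}=\frac{C-C}{2}$. The number $\delta_{\mathrm{HM}}=\delta_{\mathrm{HM}}(C)$ is the smallest factor with $C_{\mathrm{AM}}\subset\delta_{\mathrm{HM}}C_{\mathrm{HM}}$, i.e. $\delta_{\mathrm{HM}}=R(C_{\mathrm{AM}},C_{\mathrm{HM}})$. The harmonic diameter is $D_{\mathrm{HM}}(K,C)=\max_{x,y\in K}\frac12(\|x-y\|_C+\|x-y\|_{-C})$. For a $0$-symmetric gauge $B$, $D(K,B)=\max_{x,y\in K}\|x-y\|_B$. A convex body $K$ is complete (with respect to $D_{\mathrm{HM}}(\cdot,C)$) if $D_{\mathrm{HM}}(K',C)>D_{\mathrm{HM}}(K,C)$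 for every convex body $K'\supsetneq K$. A completion of $K$ is a complete convex body $K^*\supset K$ with $D_{\mathrm{HM}}(K^*,C)=D_{\mathrm{HM}}(K,C)$. *)

(* Defs.v *)
From HB Require Import structures.
From mathcomp Require Import all_boot all_order all_algebra.
From mathcomp Require Import boolp classical_sets reals topology normedtype convex.

Set Implicit Arguments.
Unset Strict Implicit.
Unset Printing Implicit Defensive.

Import Order.TTheory GRing.Theory Num.Theory.
Import numFieldNormedType.Exports.

Local Open Scope classical_set_scope.
Local Open Scope ring_scope.

Definition dot (R : realType) (n : nat) (a x : 'rV[R]_n) : R :=
  \sum_(i < n) a 0 i * x 0 i.

Definition oppset (R : realType) (n : nat) (A : set 'rV[R]_n) : set 'rV[R]_n :=
  [set - x | x in A].

Definition scaleset (R : realType) (n : nat) (c : R) (A : set 'rV[R]_n) :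
    set 'rV[R]_n :=
  [set c *: x | x in A].

Definition convex_body (R : realType) (n : nat) (K : set 'rV[R]_n) : Prop :=
  [/\ K !=set0, compact K & convex_set (K : set (convex_lmodType 'rV[R]_n))].

(* The infimum is a minimum whenever C is a convex body with 0 in its
   interior. *)
Definition gauge_fun (R : realType) (n : nat) (C : set 'rV[R]_n)
    (x : 'rV[R]_n) : R :=
  inf [set l : R | 0 <= l /\ scaleset l C x].

Definition polar (R : realType) (n : nat) (C : set 'rV[R]_n) : set 'rV[R]_n :=
  [set a | forall x, C x -> dot a x <= 1].

Definition circumradius (R : realType) (n : nat) (K C : set 'rV[R]_n) : R :=
  inf [set rho : R | 0 <= rho /\
    exists t : 'rV[R]_n, K `<=` [set t + y | y in scaleset rho C]].

Definition asymmetry (R : realType) (n : nat) (C : set 'rV[R]_n) : R :=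
  circumradius C (oppset C).

Definition Minkowski_centered (R : realType) (n : nat) (C : set 'rV[R]_n) :
    Prop :=
  C `<=` scaleset (- asymmetry C) C.

Definition arith_mean (R : realType) (n : nat) (C : set 'rV[R]_n) :
    set 'rV[R]_n :=
  [set 2^-1 *: (x - y) | x in C & y in C].

Definition harm_mean (R : realType) (n : nat) (C : set 'rV[R]_n) :
    set 'rV[R]_n :=
  polar (arith_mean (polar C)).

Definition delta_HM (R : realType) (n : nat) (C : set 'rV[R]_n) : R :=
  inf [set d : R | 0 <= d /\ arith_mean C `<=` scaleset d (harm_mean C)].

(* In diam and diam_HM the supremum is a maximum when K is a convex body and 0
   is interior to the gauge body. *)
Definition diam (R : realType) (n : nat) (K B : set 'rV[R]_n) : R :=
  sup [set gauge_fun B (x - y) | x in K & y in K].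

Definition diam_HM (R : realType) (n : nat) (K C : set 'rV[R]_n) : R :=
  sup [set 2^-1 * (gauge_fun C (x - y) + gauge_fun (oppset C) (x - y))
      | x in K & y in K].

Definition complete_HM (R : realType) (n : nat) (C K : set 'rV[R]_n) : Prop :=
  convex_body K /\
  forall K' : set 'rV[R]_n, convex_body K' -> K `<` K' ->
    diam_HM K C < diam_HM K' C.

Definition completion_HM (R : realType) (n : nat) (C K K' : set 'rV[R]_n) :
    Prop :=
  [/\ complete_HM C K', K `<=` K' & diam_HM K' C = diam_HM K C].

Lemma delta_HM_circumradius (R : realType) (n : nat) (C : set 'rV[R]_n) :
  delta_HM C = circumradius (arith_mean C) (harm_mean C).
Proof.
have dotB (a b x : 'rV[R]_n) :
    dot (2^-1 *: (a - b)) x = 2^-1 * (dot a x + dot b (- x)).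
  rewrite /dot -big_split mulr_sumr; apply: eq_bigr => i _.
  by rewrite !mxE /= mulrN -mulrA mulrBl.
have amN (A : set 'rV[R]_n) x : arith_mean A x -> arith_mean A (- x).
  case=> u Au [v Av <-]; exists v => //; exists u => //.
  by rewrite -scalerN opprB.
congr inf; apply/seteqP; split=> d /= [d0 H]; split=> //.
  by exists 0 => x /H Hx; exists x => //; rewrite add0r.
case: H => t H x Ax.
have [_ [h Hh <-] e1] := H _ Ax; have [_ [k Hk <-] e2] := H _ (amN _ _ Ax).
exists (2^-1 *: (h - k)).
  move=> y Ay; rewrite dotB ler_pdivrMl // mulr1.
  rewrite (_ : 2 = 1 + 1) // lerD //; first exact: Hh.
  exact/Hk/amN.
rewrite scalerA mulrC -scalerA scalerBr.
have -> : d *: h - d *: k = x + x.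
  by rewrite -{2}[x]opprK -e2 -{1}e1 [t + d *: h]addrC addrKA.
by rewrite -(mulr2n x) -(scaler_nat 2 x) scalerA mulVf ?scale1r // pnatr_eq0.
Qed.

(* Main.v *)
Require Import Defs.
From mathcomp Require Import all_boot all_order all_algebra interval_inference.
From mathcomp Require Import boolp classical_sets functions reals topology.
From mathcomp Require Import normedtype convex derive ring lra.

Import Order.TTheory GRing.Theory Num.Theory.
Import numFieldNormedType.Exports.

Local Open Scope classical_set_scope.
Local Open Scope ring_scope.

(** Write g for the gauge of C, s for its asymmetry, B for its harmonic mean and
    N x = (g x + g (- x)) / 2.

    The support function of C° is g, so that of (C° - C°) / 2 is N, and the
    polar B of that set is the unit ball of the norm N ([harm_meanP]).  The only
    deep ingredient is that g is not larger than the support function of C°: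
    this is a separation theorem, obtained here from the nearest point of C
    ([nearest_point_obtuse], [gauge_gt_polar]).  Consequently the harmonic
    diameter is the diameter for the norm N ([diam_HM_harm_mean]), and
    D(C, B) = 2 delta_HM, since the least d with (C - C) / 2 inside d B is half
    the largest N-distance between points of C ([diam_delta_HM]).

    The circumradius R(C, B) is always (s + 1) / 2
    ([circumradius_harm_mean]).  Centering reads g (- x) <= s * g x, which gives
    N <= (s + 1) / 2 on C.  Read as g x >= g (- x) / s, it
    gives 2 N x >= (1 + 1 / s) g (- x); so if C were inside t + rho B with
    rho < (s + 1) / 2, every x in C would satisfy
    g (t - x) <= 2 rho s / (s + 1) < s, and C would fit in a translate of
    - m C for some m < s, against the minimality of s.

    Hence (i) and (iii) both say D(C, B) = s + 1.  The ball (s + 1) / 2 B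
    contains C, has diameter s + 1 ([harm_ball_diam]), and is complete as any
    ball of a norm is: an added point x is further than the diameter from the
    point of the ball opposite to x ([harm_ball_complete]).  So being a
    completion of C amounts to having the diameter of C, and (ii) also says
    D(C, B) = s + 1. *)

(** * The scalar product *)

Lemma continuous_bigsum (R : realType) (T : topologicalType) (I : Type)
    (r : seq I) (F : I -> T -> R) :
  (forall i, continuous (F i)) -> continuous (fun x => \sum_(i <- r) F i x).
Proof.
move=> cF; elim: r => [|i r IH].
  by rewrite (_ : (fun _ => _) = cst 0);
     [exact: cst_continuous | apply/funext => x; rewrite big_nil].
rewrite (_ : (fun _ => _) = (fun x => F i x + \sum_(j <- r) F j x)).
  by move=> x; apply: continuousD; [exact: cF | exact: IH].
by apply/funext => x; rewrite big_cons.
Qed.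

Section DotProduct.
Context {R : realType} {n : nat}.
Implicit Types a b x y : 'rV[R]_n.

Lemma dotC a x : dot a x = dot x a.
Proof. by apply: eq_bigr => i _; rewrite mulrC. Qed.

Lemma dotDr a x y : dot a (x + y) = dot a x + dot a y.
Proof.
by rewrite /dot -big_split; apply: eq_bigr => i _; rewrite mxE mulrDr.
Qed.

Lemma dotZr a k x : dot a (k *: x) = k * dot a x.
Proof.
by rewrite /dot mulr_sumr; apply: eq_bigr => i _; rewrite mxE mulrCA.
Qed.

Lemma dotDl a b x : dot (a + b) x = dot a x + dot b x.
Proof. by rewrite dotC dotDr !(dotC x). Qed.

Lemma dotZl k a x : dot (k *: a) x = k * dot a x.
Proof. by rewrite dotC dotZr dotC. Qed.

Lemma dotNr a x : dot a (- x) = - dot a x.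
Proof. by rewrite -scaleN1r dotZr mulN1r. Qed.

Lemma dotNl a x : dot (- a) x = - dot a x.
Proof. by rewrite dotC dotNr dotC. Qed.

Lemma dot0l x : dot 0 x = 0.
Proof. by rewrite -(scale0r 0) dotZl mul0r. Qed.

Lemma dot_subZ a k x :
  dot (a + - k *: x) (a + - k *: x) =
  dot a a - 2 * k * dot a x + k ^+ 2 * dot x x.
Proof. by rewrite !(dotDl, dotDr, dotZl, dotZr) (dotC x a); ring. Qed.

Lemma dot_ge0 a : 0 <= dot a a.
Proof. by apply: sumr_ge0 => i _; rewrite -expr2 sqr_ge0. Qed.

Lemma dot_eq0 a : dot a a = 0 -> a = 0.
Proof.
move/eqP; rewrite psumr_eq0 => [|i _]; last by rewrite -expr2 sqr_ge0.
move/allP=> a0; apply/rowP=> i; rewrite mxE.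
by have := a0 i (mem_index_enum i); rewrite mulf_eq0 orbb => /eqP.
Qed.

Lemma dot_continuous a : continuous (dot a).
Proof.
apply: continuous_bigsum => i x.
by apply: continuousM; [exact: cst_continuous | exact: coord_continuous].
Qed.

Lemma dot_sub_continuous y : continuous (fun x => dot (y - x) (y - x)).
Proof.
apply: continuous_bigsum => i.
have c : continuous (fun x => (y - x) 0 i).
  rewrite (_ : (fun _ => _) = (fun x => y 0 i - x 0 i)).
    move=> x; apply: continuousB; first exact: cst_continuous.
    exact: coord_continuous.
  by apply/funext => x; rewrite !mxE.
by move=> x; apply: continuousM; exact: c.
Qed.

Lemma polar_closed (A : set 'rV[R]_n) : closed (polar A).
Proof.
rewrite (_ : polar A = \bigcap_(x in A) (dot x @^-1` [set z | z <= 1])).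
  apply: closed_bigI => x _; apply: preimage_closed; last exact: closed_le.
  by move=> y _; exact: dot_continuous.
by apply/seteqP; split=> a Pa x Ax /=; rewrite dotC; exact: Pa.
Qed.
End DotProduct.

(** * Separation by nearest points *)

Lemma convex_set_comb {R : realType} {n : nat} {K : set 'rV[R]_n}
    {x y : 'rV[R]_n} {t : R} :
  convex_set (K : set (convex_lmodType 'rV[R]_n)) -> K x -> K y ->
  0 <= t -> t <= 1 -> K (t *: x + (1 - t) *: y).
Proof.
move=> cK Kx Ky t0 t1.
exact: set_mem (cK x y (Itv01 t0 t1) (mem_set Kx) (mem_set Ky)).
Qed.

(** The nearest point p of K to y works: if x in K had a positive scalar product
    of y - p with x - p, moving from p a little towards x would decrease the
    distance to y. *)
Lemma nearest_point_obtuse {R : realType} {n : nat} {K : set 'rV[R]_n}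
    (y : 'rV[R]_n) :
  convex_body K ->
  exists2 p, K p & forall x, K x -> dot (y - p) x <= dot (y - p) p.
Proof.
case=> K0 Kc Kconv.
have [|p /set_mem Kp pmin] :=
    compact_EVT_min K0 Kc (f := fun x : 'rV[R]_n => dot (y - x) (y - x)).
  exact/continuous_subspaceT/dot_sub_continuous.
exists p => // x Kx; rewrite leNgt; apply/negP => lt_px.
set a := y - p in lt_px *; pose d := x - p.
have u0 : 0 < dot a d by rewrite dotDr dotNr subr_gt0.
have v0 := dot_ge0 d.
(* The squared distance drops by t * (2 * dot a d - t * dot d d) at step t, and
   this t in [0, 1] satisfies t * dot d d <= dot a d. *)
pose t := dot a d / (dot a d + dot d d).
have s0 : 0 < dot a d + dot d d by lra.
have t0 : 0 <= t by rewrite divr_ge0 ?ltW.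
have t1 : t <= 1 by rewrite ler_pdivrMr //; lra.
have et : t * (dot a d + dot d d) = dot a d by rewrite divfK ?gt_eqF.
have /mem_set /pmin := convex_set_comb Kconv Kx Kp t0 t1.
have -> : y - (t *: x + (1 - t) *: p) = a + (- t) *: d.
  by apply/rowP => i; rewrite /a /d !mxE; ring.
rewrite -/a dot_subZ.
by nra.
Qed.

(** * The gauge of a convex set around the origin *)

Section Gauge.
Context {R : realType} {n : nat}.
Implicit Types (C K : set 'rV[R]_n) (x y : 'rV[R]_n).

(** If x is in no multiple of C, the infimum is that of the empty set, namely 0. *)
Lemma gauge_ge0 C x : 0 <= gauge_fun C x.
Proof.
rewrite /gauge_fun; set S := [set l | _].
have [->|/set0P S0] := eqVneq S set0; first by rewrite inf0.
by apply: lb_le_inf => // l [].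
Qed.

Lemma gauge_le C l x : 0 <= l -> scaleset l C x -> gauge_fun C x <= l.
Proof. by move=> l0 Cx; apply: ge_inf => //; exists 0 => m []. Qed.

Lemma gauge_oppset C x : gauge_fun (oppset C) x = gauge_fun C (- x).
Proof.
congr inf; apply/seteqP; split=> l /= [l0 H]; split=> //.
  by case: H => _ [c Cc <-] <-; exists c => //; rewrite scalerN opprK.
case: H => c Cc e; exists (- c); first by exists c.
by rewrite scalerN e opprK.
Qed.

Lemma interior0_ball C : interior C 0 ->
  exists2 r, 0 < r & forall x, `|x| < r -> C x.
Proof.
move=> /nbhs_ballP[r /= r0 Cr]; exists r => // x xr.
by apply: Cr; rewrite -ball_normE /= sub0r normrN.
Qed.

Lemma interior0_absorbing C : interior C 0 ->
  exists2 c, 0 < c & forall x, scaleset (c * `|x|) C x.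
Proof.
move=> /interior0_ball[r r0 Cr]; exists (2 / r); first by rewrite divr_gt0.
move=> x; have [->|x0] := eqVneq x 0.
  by exists 0; [apply: Cr; rewrite normr0 | rewrite scaler0].
have k0 : 0 < 2 / r * `|x| by rewrite mulr_gt0 ?divr_gt0 ?normr_gt0.
exists ((2 / r * `|x|)^-1 *: x); last by rewrite scalerA divff ?scale1r ?gt_eqF.
apply: Cr; rewrite normrZ ger0_norm ?invr_ge0 ?(ltW k0) //.
rewrite ltr_pdivrMl // mulrAC divfK ?gt_eqF //.
by rewrite ltr_pMl ?normr_gt0 // ltr1n.
Qed.

Lemma gauge_le_norm C : interior C 0 ->
  exists2 c, 0 < c & forall x, gauge_fun C x <= c * `|x|.
Proof.
move=> /interior0_absorbing[c c0 Cc]; exists c => // x.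
by apply: gauge_le => //; rewrite mulr_ge0 // ltW.
Qed.

(** A witness m < l of the infimum suffices: C is star-shaped around 0, so m C is
    inside l C. *)
Lemma gauge_lt_scaleset C l x : interior C 0 ->
    convex_set (C : set (convex_lmodType 'rV[R]_n)) ->
  gauge_fun C x < l -> scaleset l C x.
Proof.
move=> C0 Cconv gl.
have l0 : 0 < l by apply: le_lt_trans gl; exact: gauge_ge0.
have CC0 : C 0 by exact: interior_subset.
have S0 : [set l : R | 0 <= l /\ scaleset l C x] !=set0.
  have [c c0 Cc] := interior0_absorbing _ C0.
  by exists (c * `|x|); split=> //; rewrite mulr_ge0 // ltW.
have [m [m0 [c Cc <-]] ml] := inf_lt S0 gl.
exists ((m / l) *: c + (1 - m / l) *: 0).
  apply: convex_set_comb => //; first by rewrite divr_ge0 // ltW.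
  by rewrite ler_pdivrMr // mul1r ltW.
by rewrite scaler0 addr0 scalerA mulrC divfK ?gt_eqF.
Qed.

Lemma gauge0 C : C 0 -> gauge_fun C 0 = 0.
Proof.
move=> C0; apply/eqP; rewrite eq_le gauge_ge0 andbT.
by apply: gauge_le => //; exists 0 => //; rewrite scaler0.
Qed.

(** The infimum defining the gauge is approached from above, hence the e. *)
Lemma scaleset_gauge_add C x : interior C 0 ->
    convex_set (C : set (convex_lmodType 'rV[R]_n)) ->
  forall e, 0 < e -> scaleset (gauge_fun C x + e) C x.
Proof. by move=> C0 Cconv e e0; apply: gauge_lt_scaleset; rewrite // ltrDl. Qed.

Lemma gaugeZ C k x : interior C 0 ->
    convex_set (C : set (convex_lmodType 'rV[R]_n)) ->
  0 <= k -> gauge_fun C (k *: x) = k * gauge_fun C x.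
Proof.
move=> C0 Cconv.
have le_gaugeZ m y : 0 < m -> gauge_fun C (m *: y) <= m * gauge_fun C y.
  move=> m0; rewrite -ler_pdivrMl //; apply/ler_addgt0Pr => e e0.
  have [c Cc yE] := scaleset_gauge_add _ y C0 Cconv _ e0.
  rewrite ler_pdivrMl //; apply: gauge_le; last first.
    by exists c => //; rewrite -scalerA yE.
  by rewrite mulr_ge0 ?addr_ge0 ?gauge_ge0 // ltW.
rewrite le_eqVlt => /predU1P[<-|k0].
  by rewrite scale0r mul0r gauge0 //; exact: interior_subset.
apply/eqP; rewrite eq_le le_gaugeZ //= -ler_pdivlMl //.
by rewrite -{1}[x](scalerK (negbT (gt_eqF k0))) le_gaugeZ ?invr_gt0.
Qed.

(** With x in l C and y in m C, the point (x + y) / (l + m) is the convex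
    combination of points of C with weights l / (l + m) and m / (l + m). *)
Lemma gaugeD C x y : interior C 0 ->
    convex_set (C : set (convex_lmodType 'rV[R]_n)) ->
  gauge_fun C (x + y) <= gauge_fun C x + gauge_fun C y.
Proof.
move=> C0 Cconv; apply/ler_addgt0Pr => e e0.
have e2 : 0 < e / 2 by rewrite divr_gt0.
have [c Cc] := scaleset_gauge_add _ x C0 Cconv _ e2.
have [d Cd] := scaleset_gauge_add _ y C0 Cconv _ e2.
set m := _ + _; set l := _ + _ => yE xE.
have l0 : 0 < l by rewrite ltr_wpDl ?gauge_ge0.
have m0 : 0 < m by rewrite ltr_wpDl ?gauge_ge0.
rewrite (_ : _ + e = l + m); last by rewrite /l /m; field.
have lm0 : 0 < l + m by rewrite addr_gt0.
apply: gauge_le; first exact: ltW.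
exists (l / (l + m) *: c + (1 - l / (l + m)) *: d).
  apply: convex_set_comb => //; first by rewrite divr_ge0 // ltW.
  by rewrite ler_pdivrMr // mul1r lerDl ltW.
rewrite scalerDr !scalerA mulrBr mulr1 [_ * (l / _)]mulrC divfK ?gt_eqF //.
by rewrite (addrC l) addrK xE yE.
Qed.

Lemma norm_le_gauge C : compact C -> interior C 0 ->
    convex_set (C : set (convex_lmodType 'rV[R]_n)) ->
  exists2 M, 0 < M & forall x, `|x| <= M * gauge_fun C x.
Proof.
move=> /compact_bounded/ex_strict_bound_gt0[M M0 CM] C0 Cconv.
exists M => // x; rewrite -ler_pdivrMl //; apply/ler_addgt0Pr => e e0.
have [c Cc xE] := scaleset_gauge_add _ x C0 Cconv _ e0.
rewrite ler_pdivrMl // -{1}xE normrZ ger0_norm ?addr_ge0 ?gauge_ge0 ?(ltW e0) //.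
rewrite mulrC ler_wpM2r ?addr_ge0 ?gauge_ge0 ?(ltW e0) //.
by apply/ltW/CM.
Qed.

(** The support function of the polar is at least the gauge: for 0 < m < g x,
    the point x / m is outside C; the vector a from its nearest point p in C
    separates it from C, and dot a p > 0 because C contains a small positive
    multiple of a.  Thus a / dot a p is in the polar, with value > m at x. *)
Lemma gauge_gt_polar C l x : convex_body C -> interior C 0 ->
  l < gauge_fun C x -> exists2 a, polar C a & l < dot a x.
Proof.
move=> Cbody C0 lg; have [_ _ Cconv] := Cbody.
have [l0|l0] := ltP l 0.
  by exists 0; [move=> y _; rewrite dot0l ler01 | rewrite dot0l].
(* The point to separate is x / m, which needs m > 0 while l may be 0. *)
pose m := (l + gauge_fun C x) / 2.
have m0 : 0 < m by rewrite /m; lra.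
have lm : l < m by rewrite /m; lra.
have [p Cp pmax] := nearest_point_obtuse (m^-1 *: x) Cbody.
set a := _ - p in pmax.
have a0 : a != 0.
  rewrite subr_eq0; apply/eqP => e.
  have : gauge_fun C x <= m.
    apply: gauge_le; first exact: ltW.
    by exists p => //; rewrite -e scalerA divff ?scale1r ?gt_eqF.
  by rewrite /m; lra.
have aa0 : 0 < dot a a.
  by rewrite lt_neqAle dot_ge0 andbT eq_sym; apply: contraNneq a0 => /dot_eq0 ->.
have ap0 : 0 < dot a p.
  have [c c0 /(_ a) [b Cb ab]] := interior0_absorbing _ C0.
  have := pmax _ Cb; apply: lt_le_trans; move: aa0; rewrite -{2}ab dotZr.
  by rewrite pmulr_rgt0 // mulr_gt0 // normr_gt0.
exists ((dot a p)^-1 *: a) => [y Cy|].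
  by rewrite dotZl ler_pdivrMl // mulr1 pmax.
rewrite dotZl ltr_pdivlMl //.
have : dot a a = m^-1 * dot a x - dot a p by rewrite {2}/a dotDr dotNr dotZr.
move=> e; have : dot a p < m^-1 * dot a x by lra.
rewrite ltr_pdivlMl //; apply: lt_trans.
by rewrite mulrC ltr_pM2r.
Qed.
End Gauge.

(** * The norm of the harmonic mean *)

Definition harm_norm (R : realType) (n : nat) (C : set 'rV[R]_n)
    (x : 'rV[R]_n) : R :=
  2^-1 * (gauge_fun C x + gauge_fun C (- x)).

Arguments harm_norm {R n} C x.

Section HarmonicNorm.
Context {R : realType} {n : nat} (C : set 'rV[R]_n).
Hypothesis C_body : convex_body C.
Hypothesis C_int0 : interior C 0.
Implicit Types (K : set 'rV[R]_n) (x y : 'rV[R]_n).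

Let C_conv : convex_set (C : set (convex_lmodType 'rV[R]_n)).
Proof. by case: C_body. Qed.

Local Notation N := (harm_norm C).
Local Notation B := (harm_mean C).

Lemma harm_norm_ge0 x : 0 <= N x.
Proof. by rewrite mulr_ge0 ?invr_ge0 ?addr_ge0 ?gauge_ge0. Qed.

Lemma harm_normN x : N (- x) = N x.
Proof. by rewrite /harm_norm opprK addrC. Qed.

Lemma harm_normD x y : N (x + y) <= N x + N y.
Proof.
have := gaugeD _ x y C_int0 C_conv; have := gaugeD _ (- x) (- y) C_int0 C_conv.
by rewrite /harm_norm opprD; lra.
Qed.

Lemma harm_normZ k x : 0 <= k -> N (k *: x) = k * N x.
Proof. by move=> k0; rewrite /harm_norm -scalerN !gaugeZ //; ring. Qed.

Lemma harm_norm_le_norm : exists2 c, 0 < c & forall x, N x <= c * `|x|.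
Proof.
have [c c0 Hc] := gauge_le_norm _ C_int0; exists c => // x.
have := Hc x; have := Hc (- x); rewrite /harm_norm normrN; lra.
Qed.

Lemma norm_le_harm_norm : exists2 M, 0 < M & forall x, `|x| <= M * N x.
Proof.
have [_ C_cpt _] := C_body.
have [M M0 HM] := norm_le_gauge _ C_cpt C_int0 C_conv; exists M => // x.
have := HM x; have := HM (- x); rewrite /harm_norm normrN.
by have := gauge_ge0 C x; have := gauge_ge0 C (- x); nra.
Qed.

Lemma harm_norm0 : N 0 = 0.
Proof. by rewrite -(scale0r 0) harm_normZ // mul0r. Qed.

Lemma harm_norm_eq0 x : N x = 0 -> x = 0.
Proof.
have [M _ /(_ x)] := norm_le_harm_norm => + Nx.
by rewrite Nx mulr0 normr_le0 => /eqP.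
Qed.

Lemma dot_polar_le a x : polar C a -> dot a x <= gauge_fun C x.
Proof.
move=> Pa; apply/ler_addgt0Pr => e e0.
have [c Cc xE] := scaleset_gauge_add _ x C_int0 C_conv _ e0.
by rewrite -{1}xE dotZr ler_piMr ?addr_ge0 ?gauge_ge0 ?(ltW e0) // Pa.
Qed.

(** Functionals a and b of the polar may be chosen independently to be nearly
    extremal at x and - x, so the support function of (C° - C°) / 2 at x is the
    mean of g x and g (- x). *)
Lemma harm_meanP x : B x <-> N x <= 1.
Proof.
split=> [Bx|Nx _ [a Pa [b Pb <-]]]; last first.
  rewrite dotC dotZl dotDl dotNl -dotNr; apply: le_trans Nx.
  by rewrite ler_pM2l ?invr_gt0 // lerD // dot_polar_le.
rewrite leNgt; apply/negP => N1.
pose d := N x - 1.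
have d0 : 0 < d by rewrite subr_gt0.
have [a Pa ax] : exists2 a, polar C a & gauge_fun C x - d < dot a x.
  by apply: gauge_gt_polar => //; rewrite ltrBlDr ltrDl.
have [b Pb bx] : exists2 b, polar C b & gauge_fun C (- x) - d < dot b (- x).
  by apply: gauge_gt_polar => //; rewrite ltrBlDr ltrDl.
have : dot (2^-1 *: (a - b)) x <= 1.
  by rewrite dotC; apply: Bx; exists a => //; exists b.
by rewrite dotZl dotDl dotNl -dotNr; move: ax bx; rewrite /d /harm_norm; lra.
Qed.

(** For r = 0 this uses that N vanishes only at 0, that is, that C is bounded. *)
Lemma scaleset_harm_meanP r x : 0 <= r -> scaleset r B x <-> N x <= r.
Proof.
move=> r0; split=> [[b /harm_meanP Nb <-]|Nx].
  by rewrite harm_normZ // ler_piMr.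
have [re|rn] := eqVneq r 0.
  exists 0; first by apply/harm_meanP; rewrite harm_norm0.
  rewrite scaler0; apply/esym/harm_norm_eq0/eqP.
  by rewrite eq_le harm_norm_ge0 -re Nx.
exists (r^-1 *: x); last by rewrite scalerA divff // scale1r.
apply/harm_meanP; rewrite harm_normZ ?invr_ge0 // ler_pdivrMl ?mulr1 //.
by rewrite lt_neqAle eq_sym rn.
Qed.

Lemma gauge_harm_mean x : gauge_fun B x = N x.
Proof.
apply/eqP; rewrite eq_le; apply/andP; split.
  by apply: gauge_le; [|apply/scaleset_harm_meanP]; rewrite ?harm_norm_ge0.
apply: lb_le_inf => [|l [l0 /scaleset_harm_meanP]]; last exact.
exists (N x); split; first exact: harm_norm_ge0.
by apply/scaleset_harm_meanP; rewrite ?harm_norm_ge0.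
Qed.

(** * Diameters with respect to the harmonic mean *)

Lemma diam_HM_harm_mean K : diam_HM K C = diam K B.
Proof.
congr sup; apply/seteqP; split=> _ [x Kx [y Ky <-]]; exists x => //;
    exists y => //.
  by rewrite gauge_harm_mean gauge_oppset.
by rewrite gauge_harm_mean gauge_oppset.
Qed.

(** Compactness of K makes the set of distances bounded, so that its supremum is
    meaningful. *)
Lemma harm_diam_ge K x y : compact K -> K x -> K y -> N (x - y) <= diam K B.
Proof.
move=> /compact_bounded/ex_strict_bound_gt0[M M0 KM] Kx Ky.
rewrite -gauge_harm_mean; apply: ub_le_sup; last by exists x => //; exists y.
have [c c0 Hc] := harm_norm_le_norm.
exists (c * (M + M)) => _ [u Ku [v Kv <-]]; rewrite gauge_harm_mean.
apply: le_trans (Hc _) _; rewrite ler_pM2l //.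
by apply: le_trans (ler_normB _ _) _; rewrite lerD // ltW // KM.
Qed.

Lemma harm_diam_le K D : K !=set0 ->
  (forall x y, K x -> K y -> N (x - y) <= D) -> diam K B <= D.
Proof.
move=> [k Kk] KD; apply: ge_sup => [|_ [x Kx [y Ky <-]]].
  by exists (gauge_fun B (k - k)); exists k => //; exists k.
by rewrite gauge_harm_mean KD.
Qed.

(** Half the N-distance of x and y in C is the norm of the point (x - y) / 2 of
    the arithmetic mean. *)
Lemma diam_delta_HM : diam C B = 2 * delta_HM C.
Proof.
have [C_ne C_cpt _] := C_body; have [c0 Cc0] := C_ne.
have NB d x y : 0 <= d -> scaleset d B (2^-1 *: (x - y)) <-> N (x - y) <= 2 * d.
  move=> d0; rewrite scaleset_harm_meanP // harm_normZ ?invr_ge0 //.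
  by rewrite ler_pdivrMl.
have D0 : 0 <= diam C B.
  by apply: le_trans (harm_diam_ge _ _ _ C_cpt Cc0 Cc0); exact: harm_norm_ge0.
have Sd : [set d : R | 0 <= d /\ arith_mean C `<=` scaleset d B] (diam C B / 2).
  have h0 : 0 <= diam C B / 2 by rewrite divr_ge0.
  split=> // _ [x Cx [y Cy <-]]; apply/NB => //.
  by rewrite mulrC divfK // harm_diam_ge.
apply/eqP; rewrite eq_le -ler_pdivrMl // [_^-1 * _]mulrC; apply/andP; split.
  apply: lb_le_inf => [|d [d0 Hd]]; first by exists (diam C B / 2).
  rewrite ler_pdivrMr // mulrC; apply: harm_diam_le => // x y Cx Cy.
  by apply/NB => //; apply: Hd; exists x => //; exists y.
by rewrite -ler_pdivlMl // mulrC; apply: ge_inf => //; exists 0 => d [].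
Qed.

(** * Balls of the norm *)

Lemma harm_ball_body r : 0 <= r -> convex_body (scaleset r B).
Proof.
move=> r0; split.
- by exists 0; apply/scaleset_harm_meanP; rewrite ?harm_norm0.
- apply: continuous_compact.
    by apply: continuous_subspaceT => x; exact: scaler_continuous.
  apply: bounded_closed_compact; last exact: polar_closed.
  have [M M0 HM] := norm_le_harm_norm.
  exists M; split; first exact: num_real.
  move=> e le x /harm_meanP Nx; apply: le_trans (ltW le).
  by apply: le_trans (HM x) _; rewrite ler_piMr // ltW.
- have N_comb (u v : 'rV[R]_n) (t : R) : 0 <= t -> t <= 1 ->
      N u <= r -> N v <= r -> N (t *: u + (1 - t) *: v) <= r.
    move=> t0 t1 Nu Nv; apply: le_trans (harm_normD _ _) _.
    by rewrite !harm_normZ ?subr_ge0 //; nra.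
  move=> x y t /set_mem/(scaleset_harm_meanP _ _ r0) Nx.
  move=> /set_mem/(scaleset_harm_meanP _ _ r0) Ny.
  by apply/mem_set/scaleset_harm_meanP => //; exact: N_comb.
Qed.

(** In dimension 0 the diameter would be 0: the value 2 r is reached by two
    opposite vectors of norm r. *)
Lemma harm_ball_diam r : (0 < n)%N -> 0 <= r -> diam (scaleset r B) B = 2 * r.
Proof.
move=> n0 r0; have [_ cpt _] := harm_ball_body _ r0.
apply/eqP; rewrite eq_le; apply/andP; split.
  apply: harm_diam_le => [|x y /scaleset_harm_meanP Nx /scaleset_harm_meanP Ny].
    by have [] := harm_ball_body _ r0.
  have := harm_normD x (- y); rewrite harm_normN.
  by have := Nx r0; have := Ny r0; lra.
pose u : 'rV[R]_n := const_mx 1.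
have Nu : 0 < N u.
  rewrite lt_neqAle harm_norm_ge0 andbT eq_sym; apply/eqP => /harm_norm_eq0.
  by move/rowP/(_ (Ordinal n0)); rewrite !mxE; apply/eqP; rewrite oner_eq0.
pose x := (r / N u) *: u.
have k0 : 0 <= r / N u by rewrite divr_ge0 // ltW.
have Nx : N x = r by rewrite harm_normZ // divfK // gt_eqF.
have Bx : scaleset r B x by apply/scaleset_harm_meanP; rewrite ?Nx.
have BNx : scaleset r B (- x).
  by apply/scaleset_harm_meanP; rewrite ?harm_normN ?Nx.
apply: le_trans (harm_diam_ge _ _ _ cpt Bx BNx).
have -> : x - - x = 2 *: x by rewrite opprK scaler_nat mulr2n.
by rewrite harm_normZ // Nx.
Qed.

(** If K has a point x outside r B, it contains the point - (r / N x) x of r B,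
    at distance N x + r > 2 r from x. *)
Lemma harm_ball_complete r : (0 < n)%N -> 0 <= r ->
  complete_HM C (scaleset r B).
Proof.
move=> n0 r0; split; first exact: harm_ball_body.
move=> K K_body [sub /existsNP[x /not_implyP[Kx nBx]]].
have [_ K_cpt _] := K_body.
rewrite !diam_HM_harm_mean harm_ball_diam //.
have rNx : r < N x.
  by rewrite ltNge; apply/negP => h; apply: nBx; apply/scaleset_harm_meanP.
have Nx0 : 0 < N x by exact: le_lt_trans rNx.
have k0 : 0 <= r / N x by rewrite divr_ge0 // ltW.
have Ky : K (- ((r / N x) *: x)).
  apply: sub; apply/scaleset_harm_meanP => //.
  by rewrite harm_normN harm_normZ // divfK // gt_eqF.
apply: lt_le_trans (harm_diam_ge _ _ _ K_cpt Kx Ky).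
rewrite opprK -{1}[x]scale1r -scalerDl harm_normZ ?addr_ge0 //.
by rewrite [ltRHS]mulrDl mul1r divfK ?gt_eqF //; lra.
Qed.

(** * The circumradius of a Minkowski-centered body *)

Section MinkowskiCentered.
Hypothesis C_centered : Minkowski_centered C.
Hypothesis n_gt0 : (0 < n)%N.
Local Notation s := (asymmetry C).

(** If s were 0, centering would place C inside the single point 0. *)
Lemma asymmetry_gt0 : 0 < s.
Proof.
have s0 : 0 <= s.
  rewrite /asymmetry /circumradius; set S := [set rho | _].
  have [->|/set0P S0] := eqVneq S set0; first by rewrite inf0.
  by apply: lb_le_inf => // l [].
rewrite lt_neqAle s0 andbT; apply/eqP => se.
pose u : 'rV[R]_n := const_mx 1.
have [c c0 /(_ u) [v Cv uE]] := interior0_absorbing _ C_int0.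
have [w _] := C_centered _ Cv; rewrite -se oppr0 scale0r => ve.
move: uE; rewrite -ve scaler0 => /rowP/(_ (Ordinal n_gt0)).
by rewrite !mxE => /esym/eqP; rewrite oner_eq0.
Qed.

Lemma gauge_opp_le x : gauge_fun C (- x) <= s * gauge_fun C x.
Proof.
have s0 := asymmetry_gt0.
rewrite -ler_pdivrMl //; apply/ler_addgt0Pr => e e0.
have [c Cc xE] := scaleset_gauge_add _ x C_int0 C_conv _ e0.
have [d Cd cE] := C_centered _ Cc.
rewrite ler_pdivrMl //; apply: gauge_le.
  by rewrite mulr_ge0 ?addr_ge0 ?gauge_ge0 // ltW.
exists d => //; move: xE; rewrite -cE => xE.
by rewrite -{2}xE scaleNr scalerN opprK scalerA mulrC.
Qed.

Lemma harm_norm_le_asym x : C x -> N x <= (s + 1) / 2.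
Proof.
move=> Cx; have g1 : gauge_fun C x <= 1.
  by apply: gauge_le => //; exists x; rewrite ?scale1r.
have := gauge_opp_le x; have := asymmetry_gt0; rewrite /harm_norm; nra.
Qed.

(** The lower bound turns a covering of C by t + rho B into a covering of C by
    a translate of - ((m + s) / 2) C with m = 2 rho s / (s + 1): on C,
    (s + 1) g (t - x) <= s (g (x - t) + g (t - x)) <= 2 rho s. *)
Lemma circumradius_harm_mean : circumradius C B = (s + 1) / 2.
Proof.
have s0 := asymmetry_gt0.
have h0 : 0 <= (s + 1) / 2 by rewrite divr_ge0 // addr_ge0 // ltW.
have Sh : [set rho : R | 0 <= rho /\
    exists t : 'rV[R]_n, C `<=` [set t + y | y in scaleset rho B]]
    ((s + 1) / 2).
  split=> //; exists 0 => x Cx; exists x; last by rewrite add0r.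
  by apply/scaleset_harm_meanP => //; exact: harm_norm_le_asym.
apply/eqP; rewrite eq_le; apply/andP; split.
  by apply: ge_inf => //; exists 0 => l [].
apply: lb_le_inf => [|rho [rho0 [t Ct]]]; first by exists ((s + 1) / 2).
rewrite leNgt; apply/negP => rho_lt.
pose m := 2 * rho * s / (s + 1).
have mE : m * (s + 1) = 2 * rho * s by rewrite divfK // gt_eqF // addr_gt0.
have m_ge0 : 0 <= m by rewrite divr_ge0 ?addr_ge0 ?mulr_ge0 // ltW.
have ms : m < s by nra.
have gm x : C x -> gauge_fun C (t - x) <= m.
  move=> /Ct [y /(scaleset_harm_meanP _ _ rho0) Ny <-].
  have -> : t - (t + y) = - y by rewrite opprD addNKr.
  move: Ny; rewrite /harm_norm => Ny.
  rewrite -(@ler_pM2r _ (s + 1)) ?addr_gt0 // mE.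
  have := gauge_opp_le y; nra.
(* Any value strictly between m and s would do: g y < l puts y inside l C. *)
have : s <= (m + s) / 2.
  apply: ge_inf; first by exists 0 => l [].
  split; first by lra.
  exists t => x Cx.
  have [|c Cc cE] :=
    @gauge_lt_scaleset _ _ C ((m + s) / 2) (t - x) C_int0 C_conv.
    by have := gm _ Cx; lra.
  exists (- (t - x)); last by rewrite opprB addrC subrK.
  by exists (- c); [exists c | rewrite scalerN cE].
lra.
Qed.
End MinkowskiCentered.
End HarmonicNorm.

(** * The equivalence *)

Theorem lemma5p2 (R : realType) (n : nat) (C : set 'rV[R]_n)
    (n_ge2 : (2 <= n)%N)
    (C_body : convex_body C)
    (C_centered : Minkowski_centered C)
    (C_int0 : interior C 0) :
  [<-> delta_HM C = (asymmetry C + 1) / 2;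
       completion_HM C C (scaleset ((asymmetry C + 1) / 2) (harm_mean C));
       diam C (harm_mean C) = 2 * circumradius C (harm_mean C)].
Proof.
have n_gt0 : (0 < n)%N by exact: ltn_trans n_ge2.
have s_gt0 := asymmetry_gt0 C C_int0 C_centered n_gt0.
have r_ge0 : 0 <= (asymmetry C + 1) / 2 by rewrite divr_ge0 // addr_ge0 // ltW.
have ball_diam := harm_ball_diam C C_body C_int0 _ n_gt0 r_ge0.
have diamE := diam_delta_HM C C_body C_int0.
have DHM K := diam_HM_harm_mean C C_body C_int0 K.
rewrite (circumradius_harm_mean C C_body C_int0 C_centered n_gt0).
tfae.
- move=> delta_max; split; first exact: harm_ball_complete.
    by move=> x Cx; apply/scaleset_harm_meanP => //; exact: harm_norm_le_asym.
  by rewrite !DHM ball_diam diamE delta_max.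
- by case=> _ _; rewrite !DHM ball_diam.
- by rewrite diamE => D; apply: (mulfI (_ : 2 != 0)); rewrite ?pnatr_eq0.
Qed.
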